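(* Consider a non-degenerate zero-drift model with small steps, and let $H_1^k$ be the discrete harmonic functions defined in the context. Then for each $k\ge1$ there is a constant $\alpha\ne0$ such that $$\lim_{\mu\to0}\mu^{k\pi/\theta+2}H_1^k(e^{-\mu x},e^{-\mu y})=\alpha\,\mathcal L(h_1^k)(x,y),\qquad\text{where }\ \mathcal L(h_1^k)(x,y)=\frac{\hat\omega(x)^k-\hat\omega(c_+y)^k}{\gamma(x,y)}.$$
   Context: Let $p_{i,j}\ge0$, $(i,j)\in\{-1,0,1\}^2$, sum to $1$. - Non-degenerate: the list $p_{1,1},p_{1,0},p_{1,-1},p_{0,-1},p_{-1,-1},p_{-1,0},p_{-1,1},p_{0,1}$ has no three consecutive zeros. - Zero drift: $\sum ip_{i,j}=\sum jp_{i,j}=0$. Kernel: $K=xy(\sum p_{i,j}x^{-i}y^{-j}-1)=\tilde a(y)x^2+\tilde b(y)x+\tilde c(y)$. Its roots in $x$ are $X_\pm(y)=(-\tilde b\pm\sqrt{\tilde b^2-4\tilde a\tilde c})/(2\tilde a)$. The discriminant has a double zero at $1$ and a zero $y_1\in[-1,1)$. The curve $X_\pm([y_1,1])$ bounds a domain $\mathcal G\ni0$. Angle: $\theta=\arccos(-\sigma_{12}/\sqrt{\sigma_{11}\sigma_{22}})$, where $\sigma_{11}=\sum i^2p_{i,j}$, $\sigma_{12}=\sum ijp_{i,j}$, $\sigma_{22}=\sum j^2p_{i,j}$. Gluing function $\omega$: the conformal gluing function of $\mathcal G$ (analytic in the interior, $\omega(0)=0$, $\omega(X_+(y))=\omega(X_-(y))$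 for $y\in[y_1,1]$, and $\omega(x)=(\beta+o(1))(1-x)^{-\pi/\theta}$ as $x\to1$, $\beta\ne0$). Branch $X_+$: analytic near $0$; if $K(0,0)=0$, assume $\partial_xK(0,0)\ne0$ (else swap $x,y$) and $X_+(0)=0$. Polynomials $P_k$: - if $K(0,0)=0$: $P_k=z^k$; - otherwise, with $d_0=\omega(X_+(0))$: $P_{2m}=z^m(z-d_0)^m$ and $P_{2m+1}=z^{m+1}(z-d_0)^m$. Discrete harmonic functions: $H_1^k=(P_k(\omega(x))-P_k(\omega(X_+(y))))/K(x,y)$, viewed as analytic functions. Continuous objects: - $\gamma(x,y)=\tfrac12(\sigma_{11}x^2+2\sigma_{12}xy+\sigma_{22}y^2)$; - $c_\pm=ce^{\pm i\theta}$ with $c=\sqrt{\sigma_{22}/\sigma_{11}}>0$, so that $\gamma(c_\pm y,y)=0$; - $\hat\omega(x)=x^{-\pi/\theta}$ (principal branch). *)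

(* Defs.v *)
(* Stdlib reals with Coquelicot's limits and complex numbers. *)
From Stdlib Require Import Reals ZArith List.
From Coquelicot Require Import Coquelicot.
Import ListNotations.
Open Scope R_scope.

Definition Rsum3 (f : Z -> R) : R := f (-1)%Z + f 0%Z + f 1%Z.
Definition Csum3 (f : Z -> C) : C := (f (-1)%Z + f 0%Z + f 1%Z)%C.

Definition is_step (i : Z) : Prop := (-1 <= i <= 1)%Z.

(* A model with small steps is a function [p : Z -> Z -> R], of which only the
   values at (i, j) in {-1,0,1}^2 are ever used. *)
Definition is_model (p : Z -> Z -> R) : Prop :=
  (forall i j, is_step i -> is_step j -> 0 <= p i j) /\
  Rsum3 (fun i => Rsum3 (fun j => p i j)) = 1.

(* The list is read linearly; under zero drift the two remaining cyclic triples
   (p_{-1,1}, p_{0,1}, p_{1,1}) and (p_{0,1}, p_{1,1}, p_{1,0}) cannot vanish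
   either unless one of the triples below does. *)
Definition step_list (p : Z -> Z -> R) : list R :=
  [p 1 1; p 1 0; p 1 (-1); p 0 (-1); p (-1) (-1); p (-1) 0; p (-1) 1; p 0 1]%Z.

Definition non_degenerate (p : Z -> Z -> R) : Prop :=
  ~ exists n : nat, (n + 2 < length (step_list p))%nat /\
      nth n (step_list p) 0 = 0 /\
      nth (n + 1) (step_list p) 0 = 0 /\
      nth (n + 2) (step_list p) 0 = 0.

Definition zero_drift (p : Z -> Z -> R) : Prop :=
  Rsum3 (fun i => Rsum3 (fun j => IZR i * p i j)) = 0 /\
  Rsum3 (fun i => Rsum3 (fun j => IZR j * p i j)) = 0.

(* The polynomial xy (sum p_{i,j} x^{-i} y^{-j} - 1), multiplied out so that it
   makes sense for x = 0 or y = 0; see [kernelE]. *)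
Definition kernel (p : Z -> Z -> R) (x y : C) : C :=
  (Csum3 (fun i => Csum3 (fun j =>
     RtoC (p i j) * x ^ Z.to_nat (1 - i) * y ^ Z.to_nat (1 - j))) - x * y)%C.

Definition ta (p : Z -> Z -> R) (y : R) : R :=
  Rsum3 (fun j => p (-1)%Z j * y ^ Z.to_nat (1 - j)).
Definition tb (p : Z -> Z -> R) (y : R) : R :=
  Rsum3 (fun j => p 0%Z j * y ^ Z.to_nat (1 - j)) - y.
Definition tc (p : Z -> Z -> R) (y : R) : R :=
  Rsum3 (fun j => p 1%Z j * y ^ Z.to_nat (1 - j)).

Lemma kernelE (p : Z -> Z -> R) (x y : C) : x <> 0 -> y <> 0 ->
  kernel p x y =
  (x * y * (Csum3 (fun i => Csum3 (fun j =>
     RtoC (p i j) * (if (i =? -1)%Z then x else if (i =? 0)%Z then 1 else / x)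
                  * (if (j =? -1)%Z then y else if (j =? 0)%Z then 1 else / y)))
            - 1))%C.
Proof.
intros hx hy; unfold kernel, Csum3.
simpl Z.to_nat; simpl Z.eqb; cbv iota; simpl Cpow.
field; auto.
Qed.

Lemma kernel_quadratic (p : Z -> Z -> R) (x : C) (y : R) :
  kernel p x y =
  (RtoC (ta p y) * x ^ 2 + RtoC (tb p y) * x + RtoC (tc p y))%C.
Proof.
unfold kernel, ta, tb, tc, Csum3, Rsum3, Rminus.
simpl Z.to_nat; rewrite !RtoC_plus, !RtoC_mult, !RtoC_opp, !RtoC_pow.
simpl Cpow; ring.
Qed.

Definition discr (p : Z -> Z -> R) (y : R) : R :=
  tb p y ^ 2 - 4 * ta p y * tc p y.

(* Principal complex square root of a real number. *)
Definition csqrt (d : R) : C :=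
  if Rle_dec 0 d then RtoC (sqrt d) else (Ci * RtoC (sqrt (- d)))%C.

(* X_+ and X_- are only evaluated at real y.  Let y1 be the zero of the
   discriminant in [-1,1).  For y in [y1,1] the two roots are complex conjugate;
   for 0 < y < y1 the discriminant is positive and X_+ is the root of smaller
   modulus, which is analytic at 0 and tends to 0 as y -> 0 if K(0,0) = 0 and
   the x-derivative of K at (0,0) is nonzero.
   The formulas are meaningless where [ta p y = 0]. *)
Definition Xp (p : Z -> Z -> R) (y : R) : C :=
  ((- RtoC (tb p y) + csqrt (discr p y)) / (2 * RtoC (ta p y)))%C.
Definition Xm (p : Z -> Z -> R) (y : R) : C :=
  ((- RtoC (tb p y) - csqrt (discr p y)) / (2 * RtoC (ta p y)))%C.

(* The finite part of X_+-([y1,1]): if p_{-1,1} = p_{0,1} = 0 then y1 = 0 and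
   both roots go to infinity as y -> 0. *)
Definition curve (p : Z -> Z -> R) (y1 : R) (x : C) : Prop :=
  exists y : R, y1 <= y <= 1 /\ ta p y <> 0 /\ (x = Xp p y \/ x = Xm p y).

Definition joined_in (A : C -> Prop) (a b : C) : Prop :=
  exists f : R -> C, (forall t, continuous f t) /\ f 0 = a /\ f 1 = b /\
    forall t, 0 <= t <= 1 -> A (f t).

(* The domain G: the connected component of 0 in the complement of the curve. *)
Definition domG (p : Z -> Z -> R) (y1 : R) (x : C) : Prop :=
  joined_in (fun z => ~ curve p y1 z) (RtoC 0) x.

(* The closure of G without the point 1. *)
Definition domG_bar (p : Z -> Z -> R) (y1 : R) (x : C) : Prop :=
  (domG p y1 x \/ curve p y1 x) /\ x <> RtoC 1.

Definition sigma11 (p : Z -> Z -> R) : R :=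
  Rsum3 (fun i => Rsum3 (fun j => IZR i ^ 2 * p i j)).
Definition sigma12 (p : Z -> Z -> R) : R :=
  Rsum3 (fun i => Rsum3 (fun j => IZR i * IZR j * p i j)).
Definition sigma22 (p : Z -> Z -> R) : R :=
  Rsum3 (fun i => Rsum3 (fun j => IZR j ^ 2 * p i j)).

Definition theta (p : Z -> Z -> R) : R :=
  acos (- sigma12 p / sqrt (sigma11 p * sigma22 p)).

(* Principal argument, in (-PI, PI], of a nonzero complex number. *)
Definition Carg (z : C) : R :=
  if Rle_dec 0 (Im z) then acos (Re z / Cmod z) else - acos (Re z / Cmod z).

(* Principal branch of z^s for z <> 0 and real s. *)
Definition cpower (z : C) (s : R) : C :=
  (RtoC (Rpower (Cmod z) s) * (cos (s * Carg z), sin (s * Carg z)))%C.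

Definition analytic_at (f : C -> C) (z0 : C) : Prop :=
  exists a : nat -> C,
    locally z0 (fun z => @is_pseries C_AbsRing C_NormedModule a (z - z0)%C (f z)).

(* A conformal map is understood to be injective; the boundary values in the
   gluing condition are those of the continuous extension of the map. *)
Record conformal_gluing (p : Z -> Z -> R) (y1 : R) (omega : C -> C) : Prop := {
  gluing_analytic : forall z, domG p y1 z -> analytic_at omega z;
  gluing_injective : forall z w, domG p y1 z -> domG p y1 w ->
    omega z = omega w -> z = w;
  gluing_boundary : forall z, domG_bar p y1 z ->
    filterlim omega (within (domG_bar p y1) (locally z)) (locally (omega z));
  gluing_0 : omega (RtoC 0) = RtoC 0;
  gluing_glue : forall y, y1 <= y <= 1 -> ta p y <> 0 ->
    omega (Xp p y) = omega (Xm p y);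
  gluing_1 : exists beta : C, beta <> RtoC 0 /\
    filterlim (fun z => omega z / cpower (1 - z) (- (PI / theta p)))%C
      (within (domG_bar p y1) (locally (RtoC 1))) (locally beta)
}.

(* d0 = omega (X_+(0)).  When p_{-1,1} = 0 the formula for X_+(0) is
   indeterminate or infinite, and the value is taken by continuity. *)
Definition is_d0 (p : Z -> Z -> R) (omega : C -> C) (d0 : C) : Prop :=
  (ta p 0 <> 0 -> d0 = omega (Xp p 0)) /\
  (ta p 0 = 0 -> filterlim (fun y => omega (Xp p y)) (at_right 0) (locally d0)).

Definition Ppoly (p : Z -> Z -> R) (d0 : C) (k : nat) (z : C) : C :=
  if Ceq_dec (kernel p 0 0) 0 then (z ^ k)%C
  else let m := Nat.div2 k in
       if Nat.even k then (z ^ m * (z - d0) ^ m)%C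
       else (z ^ (m + 1) * (z - d0) ^ m)%C.

Definition H1 (p : Z -> Z -> R) (omega : C -> C) (d0 : C) (k : nat)
    (x : C) (y : R) : C :=
  ((Ppoly p d0 k (omega x) - Ppoly p d0 k (omega (Xp p y))) / kernel p x y)%C.

Definition gamma (p : Z -> Z -> R) (x y : R) : R :=
  / 2 * (sigma11 p * x ^ 2 + 2 * sigma12 p * x * y + sigma22 p * y ^ 2).

Definition c_plus (p : Z -> Z -> R) : C :=
  (RtoC (sqrt (sigma22 p / sigma11 p)) * (cos (theta p), sin (theta p)))%C.

Definition omega_hat (p : Z -> Z -> R) (x : C) : C := cpower x (- (PI / theta p)).

Definition Lh1 (p : Z -> Z -> R) (k : nat) (x y : R) : C :=
  ((omega_hat p x ^ k - omega_hat p (c_plus p * y) ^ k) / RtoC (gamma p x y))%C.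

(* Main.v *)
(* Near the point (1,1) the kernel is
   K(x,y) = ta(y) (1-x)^2 + w(y) (1-x)(1-y) + sigma22/2 (1-y)^2 exactly, so K is
   gamma up to the factor mu^2, and 1 - X_+(y) = (1-y) D(y) with
   D(1) = c e^{-i theta}.  Both boundary arguments then approach 1 linearly in mu,
   and the asymptotics of omega at 1 together with P_k(z) ~ z^k at infinity give
   the limit with alpha = beta^k; the branch c_- found for D(1) may be replaced by
   c_+ because the power -PI/theta turns both angles +-theta into -+PI.

   The asymptotics of omega hold only in the closure of G, so one also needs
   [0,1) to lie in G.  The discriminant is (1-y)^2 q(y) with q quadratic,
   q(1) < 0 <= q(-1), hence it is <= 0 on [y1,1], and the curve meets the real
   axis only at 1 and at the double root X(y1), which never lies in [0,1). *)
Require Import Defs.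
From Stdlib Require Import Reals ZArith Lra Lia.
From Coquelicot Require Import Coquelicot.
Open Scope R_scope.

(** * Expansion of the kernel around x = 1 under zero drift *)

Ltac expand_model :=
  unfold is_model, zero_drift, sigma11, sigma12, sigma22, discr, ta, tb, tc,
    Rsum3 in *; simpl in *.

(* The coefficient of (1-x)(1-y) in [kernel_at_one]; up to the factor (1-y)^2,
   [qfun] is the discriminant. *)
Definition wfun (p : Z -> Z -> R) (y : R) : R :=
  sigma12 p - (p 0%Z (-1)%Z + 2 * p (-1)%Z (-1)%Z) * (1 - y).

Definition qfun (p : Z -> Z -> R) (y : R) : R :=
  wfun p y ^ 2 - 2 * sigma22 p * ta p y.

(** Zero drift makes the x-derivative of the kernel at x = 1, which is [2 * ta p y + tb p y], vanish
    at y = 1; [wfun] is minus the cofactor of 1 - y. *)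
Lemma tbE p y (Hp : is_model p) (Hzd : zero_drift p) :
  tb p y = - 2 * ta p y - (1 - y) * wfun p y.
Proof.
destruct Hp as [_ Hs]; destruct Hzd as [H1 H2].
unfold wfun; expand_model.
set (p00 := p 0%Z 0%Z) in *; set (p01 := p 0%Z 1%Z) in *; set (p10 := p 1%Z 0%Z) in *.
(* The two drift equations and the total mass are solved for [p10], [p01] and [p00]; what remains is
   a polynomial identity in the other six weights. *)
assert (E10 : p10 = p (-1)%Z (-1)%Z + p (-1)%Z 0%Z + p (-1)%Z 1%Z - p 1%Z (-1)%Z - p 1%Z 1%Z) by lra.
assert (E01 : p01 = p (-1)%Z (-1)%Z + p 0%Z (-1)%Z + p 1%Z (-1)%Z - p (-1)%Z 1%Z - p 1%Z 1%Z) by lra.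
clearbody p00 p01 p10; rewrite E10, E01 in *.
assert (E00 : p00 = 1 - (2 * p (-1)%Z (-1)%Z + 2 * p (-1)%Z 0%Z + p (-1)%Z 1%Z + p (-1)%Z (-1)%Z + 2 * p 0%Z (-1)%Z + p 1%Z (-1)%Z - p 1%Z 1%Z)) by lra.
rewrite E00; ring.
Qed.

(** Combined with [tbE], this amounts to K(1,y) = sigma22/2 (1-y)^2; the double zero at y = 1 again
    comes from the zero drift. *)
Lemma tcE p y (Hzd : zero_drift p) :
  tc p y = ta p y + (1 - y) * wfun p y + sigma22 p / 2 * (1 - y) ^ 2.
Proof.
destruct Hzd as [H1 H2].
unfold wfun; expand_model.
set (p01 := p 0%Z 1%Z) in *; set (p10 := p 1%Z 0%Z) in *.
assert (E10 : p10 = p (-1)%Z (-1)%Z + p (-1)%Z 0%Z + p (-1)%Z 1%Z - p 1%Z (-1)%Z - p 1%Z 1%Z) by lra.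
assert (E01 : p01 = p (-1)%Z (-1)%Z + p 0%Z (-1)%Z + p 1%Z (-1)%Z - p (-1)%Z 1%Z - p 1%Z 1%Z) by lra.
rewrite E10, E01; field.
Qed.

Lemma discrE p y (Hp : is_model p) (Hzd : zero_drift p) :
  discr p y = (1 - y) ^ 2 * qfun p y.
Proof. unfold discr, qfun; rewrite tbE, tcE by assumption; field. Qed.

Lemma ta_1 p (Hzd : zero_drift p) : ta p 1 = sigma11 p / 2.
Proof. destruct Hzd as [H1 H2]; expand_model; lra. Qed.

Lemma qfun_1 p (Hzd : zero_drift p) :
  qfun p 1 = sigma12 p ^ 2 - sigma11 p * sigma22 p.
Proof. unfold qfun, wfun; rewrite ta_1 by assumption; field. Qed.

(** * Positivity of the weights and of the covariance determinant *)

Lemma model_pos p : is_model p ->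
  0 <= p 1%Z 1%Z /\ 0 <= p 1%Z 0%Z /\ 0 <= p 1%Z (-1)%Z /\
  0 <= p 0%Z 1%Z /\ 0 <= p 0%Z 0%Z /\ 0 <= p 0%Z (-1)%Z /\
  0 <= p (-1)%Z 1%Z /\ 0 <= p (-1)%Z 0%Z /\ 0 <= p (-1)%Z (-1)%Z.
Proof.
intros [H _]; repeat split; apply H; unfold is_step; lia.
Qed.

Lemma Rmult_le_sq (A a c : R) : - A <= a <= A -> - A <= c <= A -> a * c <= A * A.
Proof.
(* The sum is twice [A * A - a * c]. *)
intros Ha Hc; assert (0 <= (A - a) * (A + c) + (A + a) * (A - c)) by nra; nra.
Qed.

(** Left and right steps have the same mass [A]. At -1, [ta] and [tc] lie in [-A, A], while [tb] is
    2A plus twice the mass of the two vertical steps. *)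
Lemma discr_m1 p : is_model p -> zero_drift p -> 0 <= discr p (-1).
Proof.
intros Hp [H1 H2]; pose proof (model_pos p Hp) as P; destruct Hp as [_ Hs].
expand_model.
set (A := p (-1)%Z (-1)%Z + p (-1)%Z 0%Z + p (-1)%Z 1%Z).
match goal with |- 0 <= ?u * (?u * 1) - 4 * ?a * ?c =>
  assert (2 * A <= u) by (unfold A; lra);
  assert (-A <= a <= A) by (unfold A; lra);
  assert (-A <= c <= A) by (unfold A; lra);
  generalize dependent u; generalize dependent c; generalize dependent a
end.
assert (0 <= A) by (unfold A; lra).
clearbody A; clear -H.
intros a Ha c Hc u Hu.
pose proof (Rmult_le_sq A a c Ha Hc); nra.
Qed.

Lemma step_triples_pos p : is_model p -> non_degenerate p ->
  0 < p 1%Z 1%Z + p 1%Z 0%Z + p 1%Z (-1)%Z /\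
  0 < p 1%Z 0%Z + p 1%Z (-1)%Z + p 0%Z (-1)%Z /\
  0 < p 1%Z (-1)%Z + p 0%Z (-1)%Z + p (-1)%Z (-1)%Z /\
  0 < p 0%Z (-1)%Z + p (-1)%Z (-1)%Z + p (-1)%Z 0%Z.
Proof.
intros Hp Hnd; pose proof (model_pos p Hp) as P.
repeat split; apply Rnot_le_lt; intros h; apply Hnd;
  [exists 0%nat|exists 1%nat|exists 2%nat|exists 3%nat]; simpl; repeat split; (lia || lra).
Qed.

(** The determinant is a sum over pairs of the four lines through the origin: product of the masses
    on the two lines times the squared cross product of their directions. Each triple of
    [step_triples_pos] misses exactly one line, so the mass cannot sit on a single line. *)
Lemma sigma_det_pos p : is_model p -> non_degenerate p ->
  0 < sigma11 p * sigma22 p - sigma12 p ^ 2.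
Proof.
intros Hp Hnd; pose proof (model_pos p Hp) as P.
destruct (step_triples_pos p Hp Hnd) as (T1 & T2 & T3 & T4).
clear Hp Hnd; expand_model.
generalize dependent (p 1%Z 1%Z); intros a.
generalize dependent (p 1%Z 0%Z); intros b.
generalize dependent (p 1%Z (-1)%Z); intros c.
generalize dependent (p 0%Z (-1)%Z); intros d.
generalize dependent (p (-1)%Z (-1)%Z); intros e.
generalize dependent (p (-1)%Z 0%Z); intros f.
generalize dependent (p (-1)%Z 1%Z); intros g.
generalize dependent (p 0%Z 1%Z); intros h.
generalize dependent (p 0%Z 0%Z); intros o.
intros.
replace (_ - _) with
 ((a + e) * (b + f) + 4 * (a + e) * (c + g) + (a + e) * (d + h) + (b + f) * (c + g)
  + (b + f) * (d + h) + (c + g) * (d + h)) by ring.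
assert (forall u v, 0 <= u -> 0 <= v -> 0 <= u * v) by (intros; nra).
assert (Q : 0 <= (a + e) * (b + f) /\ 0 <= (a + e) * (c + g) /\ 0 <= (a + e) * (d + h)
  /\ 0 <= (b + f) * (c + g) /\ 0 <= (b + f) * (d + h) /\ 0 <= (c + g) * (d + h))
  by (repeat split; apply H; lra).
destruct (Rlt_dec 0 (a + e)); destruct (Rlt_dec 0 (b + f));
destruct (Rlt_dec 0 (c + g)); destruct (Rlt_dec 0 (d + h)); try nra.
Qed.

Lemma sigma11_ge0 p : is_model p -> 0 <= sigma11 p.
Proof. intros Hp; pose proof (model_pos p Hp) as P; clear Hp; expand_model; lra. Qed.

Lemma sigma22_ge0 p : is_model p -> 0 <= sigma22 p.
Proof. intros Hp; pose proof (model_pos p Hp) as P; clear Hp; expand_model; lra. Qed.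

Lemma sigma_pos p : is_model p -> non_degenerate p -> 0 < sigma11 p /\ 0 < sigma22 p.
Proof.
intros Hp Hnd; pose proof (sigma_det_pos p Hp Hnd).
pose proof (sigma11_ge0 p Hp); pose proof (sigma22_ge0 p Hp); split; nra.
Qed.

(** * Sign of [qfun] and of the discriminant on [-1,1] *)

Lemma qfun_quadratic p : exists l m n, forall y, qfun p y = l * y ^ 2 + m * y + n.
Proof.
unfold qfun, wfun, ta, Rsum3; simpl.
set (s := sigma12 p); set (t := sigma22 p); set (k := p 0%Z (-1)%Z + 2 * p (-1)%Z (-1)%Z).
exists (k ^ 2 - 2 * t * p (-1)%Z (-1)%Z), (2 * k * (s - k) - 2 * t * p (-1)%Z 0%Z),
  ((s - k) ^ 2 - 2 * t * p (-1)%Z 1%Z).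
intros y; ring.
Qed.

Lemma quadratic_factor (l m n a y : R) : l * a ^ 2 + m * a + n = 0 ->
  l * y ^ 2 + m * y + n = (y - a) * (l * (y + a) + m).
Proof. intros h; rewrite <- (Rminus_0_r (_ + n)), <- h; ring. Qed.

(** Once y - a is factored out, the cofactor is affine in y, negative at 1 and at most 0 at -1,
    hence negative on (-1,1]. *)
Lemma quadratic_sign (l m n a y : R) :
  0 <= l * (-1) ^ 2 + m * -1 + n -> l * 1 ^ 2 + m * 1 + n < 0 ->
  l * a ^ 2 + m * a + n = 0 -> -1 < a < 1 -> -1 <= y <= 1 ->
  (y <= a -> 0 <= l * y ^ 2 + m * y + n) /\
  (a <= y -> l * y ^ 2 + m * y + n <= 0) /\
  (-1 < y < a -> 0 < l * y ^ 2 + m * y + n).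
Proof.
intros Hm H1 Hr h hy.
rewrite (quadratic_factor l m n a (-1)) in Hm by assumption.
rewrite (quadratic_factor l m n a 1) in H1 by assumption.
rewrite (quadratic_factor l m n a y) by assumption; clear Hr.
assert (l * (1 + a) + m < 0) by nra.
assert (l * (-1 + a) + m <= 0) by nra.
assert (l * (y + a) + m <= 0) by nra.
repeat split; intros; try nra.
assert (l * (y + a) + m < 0) by nra.
nra.
Qed.

Lemma qfun_m1 p : is_model p -> zero_drift p -> 0 <= qfun p (-1).
Proof.
intros Hp Hzd; pose proof (discr_m1 p Hp Hzd) as H.
rewrite discrE in H by assumption; lra.
Qed.

Lemma qfun_1_neg p : is_model p -> zero_drift p -> non_degenerate p -> qfun p 1 < 0.
Proof.
intros Hp Hzd Hnd; rewrite qfun_1 by assumption.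
pose proof (sigma_det_pos p Hp Hnd); lra.
Qed.

Lemma qfun_root p y : is_model p -> zero_drift p -> discr p y = 0 -> y <> 1 ->
  qfun p y = 0.
Proof.
intros Hp Hzd H hy; rewrite discrE in H by assumption.
destruct (Rmult_integral _ _ H) as [E|E]; [|exact E].
exfalso; apply hy; nra.
Qed.

Lemma qfun_sign p y1 y : is_model p -> zero_drift p -> non_degenerate p ->
  -1 < y1 < 1 -> discr p y1 = 0 -> -1 <= y <= 1 ->
  (y <= y1 -> 0 <= qfun p y) /\ (y1 <= y -> qfun p y <= 0) /\
  (-1 < y < y1 -> 0 < qfun p y).
Proof.
intros Hp Hzd Hnd h1 hd hy.
pose proof (qfun_m1 p Hp Hzd) as Hm; pose proof (qfun_1_neg p Hp Hzd Hnd) as H1.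
assert (Hr : qfun p y1 = 0) by (apply qfun_root; trivial; lra).
destruct (qfun_quadratic p) as (l & m & n & E); rewrite E in *.
apply (quadratic_sign l m n y1 y); assumption.
Qed.

(* Equality in [discr_m1] forces a walk with diagonal steps only, whose discriminant
   is a nonpositive multiple of (1 - y^2)^2. *)
Lemma discr_m1_root p y : is_model p -> zero_drift p -> non_degenerate p ->
  discr p (-1) = 0 -> discr p y <= 0.
Proof.
intros Hp [H1 H2] Hnd; pose proof (model_pos p Hp) as P.
destruct (step_triples_pos p Hp Hnd) as (T1 & _ & T3 & _).
clear Hnd; destruct Hp as [_ Hs]; expand_model.
generalize dependent (p 1%Z 1%Z); intros a.
generalize dependent (p 1%Z 0%Z); intros b.
generalize dependent (p 1%Z (-1)%Z); intros c.
generalize dependent (p 0%Z (-1)%Z); intros d.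
generalize dependent (p (-1)%Z (-1)%Z); intros e.
generalize dependent (p (-1)%Z 0%Z); intros f.
generalize dependent (p (-1)%Z 1%Z); intros g.
generalize dependent (p 0%Z 1%Z); intros h.
generalize dependent (p 0%Z 0%Z); intros o Hc Hcde H1 H2 Hs Habc Hdisc.
set (A := a + b + c) in *.
assert (EA : e + f + g = A) by (unfold A; lra).
assert (Eo : o = 1 - 2 * A - d - h) by (unfold A; lra).
assert (Hdisc' : (A + (d + h)) ^ 2 = (A - 2 * f) * (A - 2 * b)).
{ rewrite Eo in Hdisc; replace g with (A - e - f) in Hdisc by lra.
  replace a with (A - b - c) in Hdisc by (unfold A; lra). lra. }
assert (0 <= f <= A /\ 0 <= b <= A) as [Hf Hb] by (unfold A in *; lra).
assert (Hdh : d + h = 0).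
{ assert ((A - 2 * f) * (A - 2 * b) <= A * A) by (apply Rmult_le_sq; lra). nra. }
assert (Efb : f * (A - b) = 0 /\ b * (A - f) = 0).
{ rewrite Hdh in Hdisc'.
  assert (0 <= f * (A - b)) by (apply Rmult_le_pos; lra).
  assert (0 <= b * (A - f)) by (apply Rmult_le_pos; lra).
  split; lra. }
assert (f = 0 /\ b = 0) as [Ef Eb].
{ destruct Efb as [E1 E2]; destruct (Rmult_integral _ _ E1) as [E|E].
  - rewrite E in *; split; trivial; destruct (Rmult_integral _ _ E2); lra.
  (* Here [b = A]. Either [A = 0], against the first triple, or [f = A] as well; then [c], [d] and
     [e] all vanish, against the third triple. *)
  - exfalso; destruct (Rmult_integral _ _ E2); unfold A in *; lra. }
assert (d = 0 /\ h = 0) as [Ed Eh] by lra.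
unfold A in *; subst b f d h.
assert (e = a) by lra; assert (g = c) by lra; subst e g o.
match goal with |- ?x <= 0 => replace x with (- (4 * (a * c) * (1 - y ^ 2) ^ 2)) by ring end.
assert (0 <= a * c) by (apply Rmult_le_pos; lra).
pose proof (pow2_ge_0 (1 - y ^ 2)); nra.
Qed.

Lemma discr_le0 p y1 y : is_model p -> zero_drift p -> non_degenerate p ->
  -1 <= y1 < 1 -> discr p y1 = 0 -> y1 <= y <= 1 -> discr p y <= 0.
Proof.
intros Hp Hzd Hnd h1 hd hy.
(* [qfun_sign] wants its root inside (-1,1); the root -1 falls under the equality case of
   [discr_m1]. *)
destruct (Req_dec y1 (-1)) as [E|E].
- apply discr_m1_root; trivial; rewrite <- E; exact hd.
- rewrite discrE by assumption.
  destruct (qfun_sign p y1 y) as (_ & H & _); trivial; try lra.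
  assert (0 <= (1 - y) ^ 2) by apply pow2_ge_0.
  assert (qfun p y <= 0) by (apply H; lra); nra.
Qed.

(** * Signs of the kernel coefficients and location of the double root *)

Lemma ta_pos p y : is_model p -> zero_drift p -> non_degenerate p ->
  0 < y <= 1 -> 0 < ta p y.
Proof.
intros Hp Hzd Hnd hy; pose proof (model_pos p Hp) as P.
assert (H1 : 0 < ta p 1).
{ rewrite ta_1 by assumption; destruct (sigma_pos p Hp Hnd); lra. }
clear Hp Hzd; expand_model.
assert (0 < y * y) by nra.
destruct (Rlt_dec 0 (p (-1)%Z (-1)%Z)); destruct (Rlt_dec 0 (p (-1)%Z 0%Z)); nra.
Qed.

Lemma tc_pos p y : is_model p -> zero_drift p -> non_degenerate p ->
  0 < y <= 1 -> 0 < tc p y.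
Proof.
intros Hp Hzd Hnd hy; pose proof (model_pos p Hp) as P.
assert (H1 : 0 < tc p 1).
{ rewrite tcE, ta_1 by assumption; destruct (sigma_pos p Hp Hnd); lra. }
clear Hp Hzd; expand_model.
assert (0 < y * y) by nra.
destruct (Rlt_dec 0 (p 1%Z (-1)%Z)); destruct (Rlt_dec 0 (p 1%Z 0%Z)); nra.
Qed.

(** Since K(x,0) = p_{-1,1} x^2 + p_{0,1} x + p_{1,1}, the conclusion says that 0 is at most a
    simple root; it turns the condition on the derivative into one on the weights. *)
Lemma kernel_simple_root p :
  (kernel p 0 0 = RtoC 0 -> C_derive (fun x => kernel p x 0) 0 <> RtoC 0) ->
  p 1%Z 1%Z = 0 -> p 0%Z 1%Z <> 0.
Proof.
intros HK E11 E01.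
assert (E : forall t : R, kernel p (t, 0) 0 = RtoC (p (-1)%Z 1%Z * (t * t))).
{ intros t; unfold kernel, Csum3; simpl; rewrite E11, E01.
  apply injective_projections; simpl; ring. }
apply HK; [change (RtoC 0) with (0, 0); rewrite E; apply injective_projections; simpl; ring|].
(* [C_derive] takes the limits of the real and imaginary parts of the difference quotient along real
   increments t. These parts are p_{-1,1} t and 0, the two cases treated here. *)
assert (L : forall f : R -> R, (forall t, t <> 0 -> f t = p (-1)%Z 1%Z * t) \/
    (forall t, t <> 0 -> f t = 0) -> Lim f 0 = Finite 0).
{ intros f [Hf|Hf].
  - apply is_lim_unique, is_lim_ext_loc with (fun t => p (-1)%Z 1%Z * t).
    + exists (mkposreal 1 Rlt_0_1); intros t _ ht; rewrite Hf; trivial.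
    + evar_last; [apply is_lim_scal_l, is_lim_id|simpl; f_equal; ring].
  - apply is_lim_unique, is_lim_ext_loc with (fun t => 0).
    + exists (mkposreal 1 Rlt_0_1); intros t _ ht; rewrite Hf; trivial.
    + apply is_lim_const. }
assert (E' : forall t : R, t <> 0 ->
  ((kernel p (t, 0) 0 - kernel p (0, 0) 0) / ((t, 0) - (0, 0)))%C
    = RtoC (p (-1)%Z 1%Z * t)).
{ intros t ht; rewrite !E; apply injective_projections; simpl; field; lra. }
unfold C_derive, C_lim.
rewrite !L; trivial; [right|left]; intros t ht.
- exact (f_equal snd (E' t ht)).
- exact (f_equal fst (E' t ht)).
Qed.

(** [tb] is positive at 0 and cannot vanish strictly between 0 and y: at a zero of [tb] the
    discriminant is -4 ta tc < 0, whereas it is positive to the left of its root y. *)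
Lemma tb_pos_at_root p y : is_model p -> zero_drift p -> non_degenerate p ->
  (p 1%Z 1%Z = 0 -> p 0%Z 1%Z <> 0) ->
  0 < y < 1 -> discr p y = 0 -> 0 < tb p y.
Proof.
intros Hp Hzd Hnd HK hy hd; apply Rnot_le_lt; intros hb.
assert (S : forall z, 0 < z < y -> tb p z <> 0).
{ intros z hz E.
  destruct (qfun_sign p y z) as (_ & _ & H); trivial; try lra.
  assert (0 < qfun p z) by (apply H; lra).
  assert (0 < discr p z) by (rewrite discrE by assumption; apply Rmult_lt_0_compat; trivial; apply pow_lt; lra).
  pose proof (ta_pos p z Hp Hzd Hnd ltac:(lra)); pose proof (tc_pos p z Hp Hzd Hnd ltac:(lra)).
  unfold discr in *; rewrite E in *; nra. }
assert (hb' : tb p y < 0).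
{ destruct hb as [hb|hb]; trivial; exfalso; unfold discr in hd; rewrite hb in hd.
  pose proof (ta_pos p y Hp Hzd Hnd ltac:(lra)); pose proof (tc_pos p y Hp Hzd Hnd ltac:(lra)); nra. }
pose proof (model_pos p Hp) as P.
assert (D0 : 0 < discr p 0).
{ destruct (qfun_sign p y 0) as (_ & _ & H); trivial; try lra.
  rewrite discrE by assumption; assert (0 < qfun p 0) by (apply H; lra); lra. }
assert (E0 : tb p 0 = p 0%Z 1%Z) by (unfold tb, Rsum3; simpl; ring).
assert (H0 : 0 < tb p 0).
{ rewrite E0; destruct (Rlt_dec 0 (p 0%Z 1%Z)) as [h|h]; trivial; exfalso.
  assert (e : p 0%Z 1%Z = 0) by lra.
  clear - P D0 e; expand_model; rewrite e in D0.
  assert (0 <= p (-1)%Z 1%Z * p 1%Z 1%Z) by (apply Rmult_le_pos; lra). lra. }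
assert (C : continuity (fun z => - tb p z)).
{ unfold tb, Rsum3; simpl; intros z; reg. }
destruct (IVT (fun z => - tb p z) 0 y C) as [z [hz Ez]]; try lra.
apply (S z); [|lra].
destruct hz as [[h1|h1] [h2|h2]]; try lra; subst; lra.
Qed.

(** Such an r would be the double root -tb/(2 ta). For y > 0 both coefficients are positive and that
    root is negative; for y = 0 it would be 0, a double root of K(x,0), which [HK] forbids; for y <
    0 masses are compared. *)
Lemma discr_root_location p y :
  is_model p -> zero_drift p -> non_degenerate p ->
  (p 1%Z 1%Z = 0 -> p 0%Z 1%Z <> 0) ->
  -1 <= y < 1 -> discr p y = 0 -> ta p y <> 0 ->
  forall r, 0 <= r < 1 -> 2 * ta p y * r + tb p y <> 0.
Proof.
intros Hp Hzd Hnd HK hy hd ha r hr E.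
destruct (Rlt_dec 0 y) as [h|h].
{ pose proof (ta_pos p y Hp Hzd Hnd ltac:(lra)).
  pose proof (tb_pos_at_root p y Hp Hzd Hnd HK ltac:(lra) hd); nra. }
pose proof (model_pos p Hp) as P.
destruct (Req_dec y 0) as [h0|h0].
- subst y; clear Hp Hzd Hnd; expand_model.
  assert (0 < p (-1)%Z 1%Z) by lra.
  assert (p 0%Z 1%Z = 0) by nra.
  apply HK; trivial; nra.
(* For y < 0, [tb] is at least (1 - p_{0,0})(-y) and [ta] is at least p_{-1,0} y. By [T2] left and
   right masses agree, so 2 p_{-1,0} <= 1 - p_{0,0}, and 2 ta r + tb > 0 follows from r < 1. *)
- pose proof (proj1 (sigma_pos p Hp Hnd)) as A; 
  pose proof (ta_1 p Hzd) as T1; pose proof (tcE p 1 Hzd) as T2.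
  destruct Hp as [_ Hs]; clear Hzd Hnd hd; expand_model.
  assert (0 <= p 0%Z (-1)%Z * (y * y)) by (apply Rmult_le_pos; nra).
  assert (0 <= p (-1)%Z (-1)%Z * (y * y)) by (apply Rmult_le_pos; nra).
  assert (p 0%Z 0%Z < 1) by lra.
  assert (0 < (1 - p 0%Z 0%Z) * (- y)) by (apply Rmult_lt_0_compat; lra).
  assert (0 <= (1 - p 0%Z 0%Z - 2 * p (-1)%Z 0%Z) * (- y)) by (apply Rmult_le_pos; lra).
  match type of ha with ?t <> 0 => set (T := t) in *; 
    assert (2 * T >= 2 * p (-1)%Z 0%Z * y) by (unfold T; lra) end.
  clearbody T. 
  destruct (Rlt_dec 0 T); nra.
Qed.

(** * The boundary curve and the real segment [0,1) *)

Lemma Xp_discr_le0 p y : discr p y <= 0 ->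
  ta p y <> 0 ->
  Xp p y = (- tb p y / (2 * ta p y), sqrt (- discr p y) / (2 * ta p y)).
Proof.
intros hd ha; unfold Xp, csqrt; destruct (Rle_dec 0 (discr p y)) as [h|h].
- replace (discr p y) with 0 by lra; rewrite Ropp_0, sqrt_0.
  apply injective_projections; simpl; field; trivial.
- apply injective_projections; simpl; field; trivial.
Qed.

Lemma Xm_discr_le0 p y : discr p y <= 0 ->
  ta p y <> 0 ->
  Xm p y = (- tb p y / (2 * ta p y), - (sqrt (- discr p y) / (2 * ta p y))).
Proof.
intros hd ha; unfold Xm, csqrt; destruct (Rle_dec 0 (discr p y)) as [h|h].
- replace (discr p y) with 0 by lra; rewrite Ropp_0, sqrt_0.
  apply injective_projections; simpl; field; trivial.
- apply injective_projections; simpl; field; trivial.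
Qed.

(** On [y1,1] the roots have imaginary parts of modulus sqrt(-discr)/(2 |ta|), so a real point of
    the curve is a double root. For y = 1 this root is 1; for the other y it is excluded by
    [discr_root_location]. *)
Lemma curve_avoids_segment p y1 r :
  is_model p -> zero_drift p -> non_degenerate p ->
  (p 1%Z 1%Z = 0 -> p 0%Z 1%Z <> 0) ->
  -1 <= y1 < 1 -> discr p y1 = 0 -> 0 <= r < 1 -> ~ curve p y1 (RtoC r).
Proof.
intros Hp Hzd Hnd HK h1 hd hr (y & hy & ha & E).
pose proof (discr_le0 p y1 y Hp Hzd Hnd h1 hd hy) as hn.
assert (Ey : sqrt (- discr p y) / (2 * ta p y) = 0 /\ r = - tb p y / (2 * ta p y)).
{ destruct E as [E|E].
  - rewrite Xp_discr_le0 in E by assumption; injection E; intros; split; lra.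
  - rewrite Xm_discr_le0 in E by assumption; injection E; intros; split; lra. }
destruct Ey as [Ei Er].
assert (hs : discr p y = 0).
{ assert (sqrt (- discr p y) = 0) by (apply (Rmult_eq_reg_r (/ (2 * ta p y))); [lra|apply Rinv_neq_0_compat; lra]).
  enough (- discr p y = 0) by lra; apply sqrt_eq_0; lra. }
assert (Et : 2 * ta p y * r + tb p y = 0) by (rewrite Er; field; trivial).
destruct (Req_dec y 1) as [h|h].
- subst y; rewrite tbE in Et by assumption.
  assert (ta p 1 * (1 - r) = 0) by lra; nra.
- apply (discr_root_location p y Hp Hzd Hnd HK) with r; trivial; lra.
Qed.

Lemma segment_in_domG p y1 r :
  is_model p -> zero_drift p -> non_degenerate p ->
  (p 1%Z 1%Z = 0 -> p 0%Z 1%Z <> 0) ->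
  -1 <= y1 < 1 -> discr p y1 = 0 -> 0 <= r < 1 -> domG p y1 (RtoC r).
Proof.
intros Hp Hzd Hnd HK h1 hd hr; exists (fun t => RtoC (t * r)); split; [|split; [|split]].
- intros t; apply (continuous_comp (fun t => t * r) RtoC).
  + apply (continuous_mult (fun t => t) (fun _ => r)); [apply continuous_id|apply continuous_const].
  + apply filterlim_locally; intros eps; exists eps; intros u hu; split; trivial; apply ball_center.
- f_equal; ring.
- f_equal; ring.
- intros t ht; apply (curve_avoids_segment p y1); trivial; nra.
Qed.

(** * Limit rules for real and complex functions along an arbitrary filter *)

Section Limits.
Context {T : Type} (F : (T -> Prop) -> Prop) {FF : Filter F}.

Lemma filterlim_Rplus (f g : T -> R) (a b : R) :
  filterlim f F (locally a) -> filterlim g F (locally b) ->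
  filterlim (fun t => f t + g t) F (locally (a + b)).
Proof.
intros hf hg; apply (filterlim_comp_2 f g Rplus hf hg), (filterlim_plus a b).
Qed.

Lemma filterlim_Rmult (f g : T -> R) (a b : R) :
  filterlim f F (locally a) -> filterlim g F (locally b) ->
  filterlim (fun t => f t * g t) F (locally (a * b)).
Proof.
intros hf hg; apply (filterlim_comp_2 f g Rmult hf hg), (filterlim_mult (K := R_AbsRing) a b).
Qed.

Lemma filterlim_Rsq (f : T -> R) (a : R) :
  filterlim f F (locally a) -> filterlim (fun t => f t ^ 2) F (locally (a ^ 2)).
Proof.
intros hf; apply filterlim_Rmult; [exact hf|].
apply filterlim_Rmult; [exact hf|apply filterlim_const].
Qed.

Lemma filterlim_Ropp (f : T -> R) (a : R) :
  filterlim f F (locally a) -> filterlim (fun t => - f t) F (locally (- a)).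
Proof.
intros hf; apply (filterlim_comp _ _ _ f Ropp _ _ _ hf), (filterlim_opp a).
Qed.

Lemma filterlim_Rinv (f : T -> R) (a : R) : a <> 0 ->
  filterlim f F (locally a) -> filterlim (fun t => / f t) F (locally (/ a)).
Proof.
intros ha hf; apply (filterlim_comp _ _ _ f Rinv _ _ _ hf), (continuous_Rinv a ha).
Qed.

Lemma filterlim_continuous_comp (f : T -> R) (g : R -> R) (a : R) :
  continuous g a ->
  filterlim f F (locally a) -> filterlim (fun t => g (f t)) F (locally (g a)).
Proof. intros hg hf; exact (filterlim_comp _ _ _ f g _ _ _ hf hg). Qed.

(** Balls of [C] are products of real balls; all complex rules below reduce to real ones through
    this equivalence. *)
Lemma filterlim_C (f : T -> C) (l : C) :
  filterlim f F (locally l) <->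
  filterlim (fun t => fst (f t)) F (locally (fst l)) /\
  filterlim (fun t => snd (f t)) F (locally (snd l)).
Proof.
split.
- intros h; destruct l as [a b]; split.
  + exact (filterlim_comp _ _ _ f fst _ _ _ h (continuous_fst a b)).
  + exact (filterlim_comp _ _ _ f snd _ _ _ h (continuous_snd a b)).
- intros [h1 h2]; apply filterlim_locally; intros eps.
  apply filterlim_locally with (eps := eps) in h1.
  apply filterlim_locally with (eps := eps) in h2.
  generalize (filter_and _ _ h1 h2); apply filter_imp; intros t [H1 H2]; split; trivial.
Qed.

Lemma filterlim_RtoC (f : T -> R) (a : R) :
  filterlim f F (locally a) -> filterlim (fun t => RtoC (f t)) F (locally (RtoC a)).
Proof. intros h; apply filterlim_C; split; [exact h|apply filterlim_const]. Qed.

Lemma filterlim_Cplus (f g : T -> C) (a b : C) :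
  filterlim f F (locally a) -> filterlim g F (locally b) ->
  filterlim (fun t => (f t + g t)%C) F (locally (a + b)%C).
Proof.
rewrite !filterlim_C; intros [f1 f2] [g1 g2]; split; apply filterlim_Rplus; trivial.
Qed.

Lemma filterlim_Copp (f : T -> C) (a : C) :
  filterlim f F (locally a) -> filterlim (fun t => (- f t)%C) F (locally (- a)%C).
Proof.
rewrite !filterlim_C; intros [f1 f2]; split; apply filterlim_Ropp; trivial.
Qed.

Lemma filterlim_Cminus (f g : T -> C) (a b : C) :
  filterlim f F (locally a) -> filterlim g F (locally b) ->
  filterlim (fun t => (f t - g t)%C) F (locally (a - b)%C).
Proof. intros hf hg; apply filterlim_Cplus, filterlim_Copp; trivial. Qed.

Lemma filterlim_Cmult (f g : T -> C) (a b : C) :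
  filterlim f F (locally a) -> filterlim g F (locally b) ->
  filterlim (fun t => (f t * g t)%C) F (locally (a * b)%C).
Proof.
rewrite !filterlim_C; intros [f1 f2] [g1 g2]; split; simpl.
- apply filterlim_Rplus; [|apply filterlim_Ropp]; apply filterlim_Rmult; trivial.
- apply filterlim_Rplus; apply filterlim_Rmult; trivial.
Qed.

Lemma filterlim_Cpow (f : T -> C) (a : C) n :
  filterlim f F (locally a) -> filterlim (fun t => (f t ^ n)%C) F (locally (a ^ n)%C).
Proof.
intros h; induction n as [|n IH]; simpl; [apply filterlim_const|].
apply filterlim_Cmult; trivial.
Qed.

Lemma filterlim_Cinv (f : T -> C) (a : C) : a <> RtoC 0 ->
  filterlim f F (locally a) -> filterlim (fun t => (/ f t)%C) F (locally (/ a)%C).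
Proof.
rewrite !filterlim_C; intros ha [f1 f2].
assert (hn : fst a ^ 2 + snd a ^ 2 <> 0).
{ intros e; apply ha; destruct a as [u v]; simpl in e.
  apply injective_projections; simpl; nra. }
assert (hi : filterlim (fun t => / (fst (f t) ^ 2 + snd (f t) ^ 2)) F
  (locally (/ (fst a ^ 2 + snd a ^ 2)))).
{ apply filterlim_Rinv; trivial; apply filterlim_Rplus; apply filterlim_Rsq; trivial. }
split; apply filterlim_Rmult; trivial; apply filterlim_Ropp, f2.
Qed.

End Limits.

(** * Principal argument and principal powers *)

Lemma continuous_acos (x : R) : -1 < x < 1 -> continuous acos x.
Proof.
intros hx; apply continuity_pt_filterlim, derivable_continuous_pt, derivable_pt_acos, hx.
Qed.

Lemma cpower_neq0 z s : cpower z s <> RtoC 0.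
Proof.
apply Cmult_neq_0; intros E; injection E.
- apply Rgt_not_eq, exp_pos.
- intros h1 h2; pose proof (sin2_cos2 (s * Carg z)); unfold Rsqr in *; nra.
Qed.

Lemma Cmod_scale r z : 0 < r -> Cmod (r * z)%C = r * Cmod z.
Proof. intros hr; rewrite Cmod_mult, Cmod_R, Rabs_pos_eq; lra. Qed.

Lemma Carg_scale r z : 0 < r -> z <> RtoC 0 -> Carg (r * z)%C = Carg z.
Proof.
intros hr hz; pose proof (proj1 (Cmod_gt_0 z) hz) as h.
unfold Carg; rewrite Cmod_scale by assumption; destruct z as [a b]; simpl.
replace ((r * a - 0 * b) / (r * Cmod (a, b))) with (a / Cmod (a, b)) by (field; lra).
destruct (Rle_dec 0 (r * b + 0 * a)); destruct (Rle_dec 0 b); trivial; exfalso; nra.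
Qed.

Lemma cpower_scale r z s : 0 < r -> z <> RtoC 0 ->
  cpower (r * z)%C s = (Rpower r s * cpower z s)%C.
Proof.
intros hr hz; unfold cpower.
rewrite Carg_scale, Cmod_scale by assumption.
rewrite <- Rpower_mult_distr, RtoC_mult; [|lra|apply Cmod_gt_0, hz].
ring.
Qed.

Lemma cpower_pos r s : 0 < r -> cpower (RtoC r) s = RtoC (Rpower r s).
Proof.
intros hr; unfold cpower, Carg.
rewrite Cmod_R, Rabs_pos_eq by lra; simpl.
destruct (Rle_dec 0 0) as [_|h]; [|lra].
replace (r / r) with 1 by (field; lra); rewrite acos_1, Rmult_0_r, cos_0, sin_0.
apply injective_projections; simpl; ring.
Qed.

Lemma Cmod_gt_Re z : snd z <> 0 -> - Cmod z < fst z < Cmod z.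
Proof.
intros h; destruct z as [a b]; simpl in *; unfold Cmod; simpl.
assert (Rabs a < sqrt (a * (a * 1) + b * (b * 1))).
{ rewrite <- sqrt_Rsqr_abs; pose proof (Rsqr_pos_lt b h); apply sqrt_lt_1_alt; unfold Rsqr in *; nra. }
apply Rabs_def2 in H; lra.
Qed.

Lemma continuous_Rpower s r : 0 < r -> continuous (fun u => Rpower u s) r.
Proof.
intros hr; apply continuity_pt_filterlim, derivable_continuous_pt.
exists (s * Rpower r (s - 1)); apply derivable_pt_lim_power; exact hr.
Qed.

(** In the open lower half-plane, where [Xp_slope p 1] lies, [Carg] is given by the single formula
    -acos(Re z / |z|), hence is continuous. *)
Lemma filterlim_cpower {T} (F : (T -> Prop) -> Prop) {FF : Filter F} (f : T -> C) (z : C) s :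
  snd z < 0 -> filterlim f F (locally z) ->
  filterlim (fun t => cpower (f t) s) F (locally (cpower z s)).
Proof.
intros hz hf.
pose proof (Cmod_gt_Re z (Rlt_not_eq _ _ hz)) as hm.
destruct (proj1 (filterlim_C F f z) hf) as [h1 h2].
assert (hM : filterlim (fun t => Cmod (f t)) F (locally (Cmod z))).
{ unfold Cmod; apply (filterlim_continuous_comp F _ sqrt); [apply continuous_sqrt|].
  apply (filterlim_Rplus F); [apply (filterlim_Rsq F), h1|apply (filterlim_Rsq F), h2]. }
assert (hA : filterlim (fun t => Carg (f t)) F (locally (Carg z))).
{ assert (Ez : forall w : C, snd w < 0 -> - acos (fst w / Cmod w) = Carg w).
  { intros w hw; unfold Carg, Im; destruct (Rle_dec 0 (snd w)); [lra|reflexivity]. }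
  rewrite <- Ez by assumption.
  apply filterlim_ext_loc with (fun t => - acos (fst (f t) / Cmod (f t))).
  - refine (filter_imp (fun t => snd (f t) < 0) _ _ (h2 _ (open_lt 0 (snd z) hz))).
    intros t ht; apply Ez; exact ht.
  - apply (filterlim_Ropp F), (filterlim_continuous_comp F _ acos).
    + apply continuous_acos; split;
        apply Rmult_lt_reg_r with (Cmod z); try lra; unfold Rdiv;
        rewrite Rmult_assoc, Rinv_l; lra.
    + apply (filterlim_Rmult F); trivial; apply (filterlim_Rinv F); trivial; lra. }
assert (hP : filterlim (fun t => Rpower (Cmod (f t)) s) F (locally (Rpower (Cmod z) s))).
{ apply (filterlim_continuous_comp F _ (fun u => Rpower u s)); trivial.
  apply continuous_Rpower; lra. }
unfold cpower; apply (filterlim_Cmult F); [apply (filterlim_RtoC F), hP|].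
assert (hS : filterlim (fun t => s * Carg (f t)) F (locally (s * Carg z))).
{ apply (filterlim_Rmult F); [apply filterlim_const|exact hA]. }
apply (filterlim_C F); split; simpl.
- apply (filterlim_continuous_comp F _ cos); trivial; apply continuous_cos.
- apply (filterlim_continuous_comp F _ sin); trivial; apply continuous_sin.
Qed.

(** * Elementary limits as mu tends to 0 from the right *)

Lemma filterlim_Rpower_0 E : 0 < E ->
  filterlim (fun mu => Rpower mu E) (at_right 0) (locally 0).
Proof.
intros hE; unfold Rpower.
apply (filterlim_comp _ _ _ (fun mu => E * ln mu) exp _ (Rbar_locally m_infty)).
- eapply filterlim_comp; [apply is_lim_ln_0|].
  assert (Em : Rbar_mult E m_infty = m_infty).
  2: { rewrite <- Em at 2; apply (filterlim_Rbar_mult_l E m_infty). }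
  simpl; destruct (Rle_dec 0 E) as [h|h]; [|lra].
  destruct (Rle_lt_or_eq_dec 0 E h); trivial; lra.
- exact is_lim_exp_m.
Qed.

Lemma filterlim_at_right_id : filterlim (fun mu : R => mu) (at_right 0) (locally 0).
Proof. intros P hP; apply filter_le_within; exact hP. Qed.

Lemma at_right_pos (P : R -> Prop) : (forall mu, 0 < mu -> P mu) -> at_right 0 P.
Proof. intros h; exists (mkposreal 1 Rlt_0_1); intros mu _ hmu; apply h, hmu. Qed.

Lemma filterlim_exp_slope x : x <> 0 ->
  filterlim (fun mu => (1 - exp (- (mu * x))) / mu) (at_right 0) (locally x).
Proof.
intros hx.
apply filterlim_ext_loc with
  (fun mu => (exp (- (mu * x)) - 1) / (- (mu * x)) * x).
{ apply at_right_pos; intros mu hmu; field; lra. }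
replace (locally x) with (locally (1 * x)) by (f_equal; ring).
apply (filterlim_Rmult (at_right 0)); [ |apply filterlim_const].
apply (filterlim_comp _ _ _ (fun mu => - (mu * x)) (fun t => (exp t - 1) / t) _ (locally' 0));
  [|exact is_lim_div_expm1_0].
(* The limit of (e^t - 1)/t is along punctured neighbourhoods, so t = -(mu x) must also be seen to
   be nonzero; this uses x <> 0 and mu > 0. *)
intros P hP; unfold locally', within in hP.
assert (h : filterlim (fun mu => - (mu * x)) (at_right 0) (locally 0)).
{ replace (locally 0) with (locally (- (0 * x))) by (f_equal; ring).
  apply (filterlim_Ropp (at_right 0)), (filterlim_Rmult (at_right 0)); [ |apply filterlim_const].
  apply filterlim_at_right_id. }
specialize (h _ hP); unfold filtermap in *.
generalize (filter_and _ _ h (at_right_pos (fun mu => 0 < mu) (fun mu h => h))).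
apply filter_imp; intros mu [H hmu]; apply H; nra.
Qed.

(** * The kernel and its root X_+ near the point (1,1) *)

Lemma kernel_at_one p X Y : is_model p -> zero_drift p ->
  kernel p (RtoC X) (RtoC Y) =
  RtoC (ta p Y * (1 - X) ^ 2 + wfun p Y * (1 - X) * (1 - Y) + sigma22 p / 2 * (1 - Y) ^ 2).
Proof.
intros Hp Hzd; rewrite kernel_quadratic, <- RtoC_pow, <- !RtoC_mult, <- !RtoC_plus.
f_equal; rewrite tbE, tcE by assumption; field.
Qed.

Lemma continuous_ta p y : continuous (ta p) y.
Proof.
apply continuity_pt_filterlim; unfold ta, Rsum3; simpl; reg.
Qed.

Lemma continuous_wfun p y : continuous (wfun p) y.
Proof. apply continuity_pt_filterlim; unfold wfun; reg. Qed.

Lemma continuous_qfun p y : continuous (qfun p) y.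
Proof.
unfold qfun.
apply (continuous_minus (fun y => wfun p y ^ 2) (fun y => 2 * sigma22 p * ta p y)).
- unfold pow; apply (continuous_mult (wfun p)); [apply continuous_wfun|].
  apply (continuous_mult (wfun p)); [apply continuous_wfun|apply continuous_const].
- apply (continuous_mult (fun _ => 2 * sigma22 p) (ta p));
    [apply continuous_const|apply continuous_ta].
Qed.

(** The quotient (1 - X_+(y))/(1 - y) where [qfun] is negative and 0 < y < 1, with 1 - y already
    cancelled so that the formula extends continuously to y = 1. *)
Definition Xp_slope (p : Z -> Z -> R) (y : R) : C :=
  (- wfun p y / (2 * ta p y), - sqrt (- qfun p y) / (2 * ta p y)).

Lemma Xp_near_1 p y : is_model p -> zero_drift p -> non_degenerate p ->
  0 < y < 1 -> qfun p y < 0 -> (1 - Xp p y = RtoC (1 - y) * Xp_slope p y)%C.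
Proof.
intros Hp Hzd Hnd hy hq; pose proof (ta_pos p y Hp Hzd Hnd ltac:(lra)) as ha.
pose proof (pow2_ge_0 (1 - y)) as hy2.
rewrite Xp_discr_le0; [|rewrite discrE by assumption; nra|lra].
rewrite discrE, tbE by assumption.
replace (- ((1 - y) ^ 2 * qfun p y)) with ((1 - y) ^ 2 * (- qfun p y)) by ring.
rewrite sqrt_mult, sqrt_pow2 by lra.
apply injective_projections; simpl; field; lra.
Qed.

Lemma Xp_slope_continuous p : is_model p -> zero_drift p -> non_degenerate p ->
  forall T (F : (T -> Prop) -> Prop) {FF : Filter F} (f : T -> R),
  filterlim f F (locally 1) ->
  filterlim (fun t => Xp_slope p (f t)) F (locally (Xp_slope p 1)).
Proof.
intros Hp Hzd Hnd T F FF f hf; pose proof (ta_pos p 1 Hp Hzd Hnd ltac:(lra)) as ha.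
assert (hi : filterlim (fun t => / (2 * ta p (f t))) F (locally (/ (2 * ta p 1)))).
{ apply (filterlim_Rinv F); [lra|]; apply (filterlim_Rmult F); [apply filterlim_const|].
  apply (filterlim_continuous_comp F f (ta p)); trivial; apply continuous_ta. }
apply (filterlim_C F); split; simpl; apply (filterlim_Rmult F); trivial;
  apply (filterlim_Ropp F).
- apply (filterlim_continuous_comp F f (wfun p)); trivial; apply continuous_wfun.
- apply (filterlim_continuous_comp F _ sqrt); [apply continuous_sqrt|].
  apply (filterlim_Ropp F), (filterlim_continuous_comp F f (qfun p)); trivial.
  apply continuous_qfun.
Qed.

(** * The angle theta, the constants c e^{+-i theta} and the form gamma *)

Lemma theta_cos_bounds p : is_model p -> non_degenerate p ->
  -1 < - sigma12 p / sqrt (sigma11 p * sigma22 p) < 1.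
Proof.
intros Hp Hnd; pose proof (sigma_det_pos p Hp Hnd) as hd.
destruct (sigma_pos p Hp Hnd) as [h1 h2].
set (S := sqrt (sigma11 p * sigma22 p)).
assert (hS : 0 < S) by (apply sqrt_lt_R0, Rmult_lt_0_compat; trivial).
assert (eS : S * S = sigma11 p * sigma22 p) by (apply sqrt_sqrt; nra).
split; apply Rmult_lt_reg_r with S; trivial; unfold Rdiv;
  rewrite Rmult_assoc, Rinv_l by lra; nra.
Qed.

Lemma theta_bounds p : is_model p -> non_degenerate p -> 0 < theta p < PI.
Proof. intros Hp Hnd; apply acos_bound_lt, theta_cos_bounds; trivial. Qed.

Lemma Carg_polar_up r t : 0 < r -> 0 < t < PI -> Carg (RtoC r * (cos t, sin t))%C = t.
Proof.
intros hr ht; pose proof (sin_gt_0 t ltac:(lra) ltac:(lra)) as hs.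
assert (hn : (cos t, sin t) <> RtoC 0) by (intros E; injection E; intros; lra).
rewrite Carg_scale by trivial; unfold Carg, Cmod, Im, Re; simpl.
replace (cos t * (cos t * 1) + sin t * (sin t * 1)) with (Rsqr (sin t) + Rsqr (cos t))
  by (unfold Rsqr; ring).
rewrite sin2_cos2, sqrt_1, Rdiv_1_r; destruct (Rle_dec 0 (sin t)); [|lra].
apply acos_cos; lra.
Qed.

Lemma Carg_polar_down r t : 0 < r -> 0 < t < PI -> Carg (RtoC r * (cos t, (- sin t)%R))%C = - t.
Proof.
intros hr ht; pose proof (sin_gt_0 t ltac:(lra) ltac:(lra)) as hs.
assert (hn : (cos t, - sin t) <> RtoC 0) by (intros E; injection E; intros; lra).
rewrite Carg_scale by trivial; unfold Carg, Cmod, Im, Re; simpl.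
replace (cos t * (cos t * 1) + - sin t * (- sin t * 1)) with (Rsqr (sin t) + Rsqr (cos t))
  by (unfold Rsqr; ring).
rewrite sin2_cos2, sqrt_1, Rdiv_1_r; destruct (Rle_dec 0 (- sin t)); [lra|].
rewrite acos_cos; lra.
Qed.

Lemma Cmod_polar_conj r t :
  Cmod (RtoC r * (cos t, (- sin t)%R))%C = Cmod (RtoC r * (cos t, sin t))%C.
Proof. rewrite !Cmod_mult; f_equal; unfold Cmod; simpl; f_equal; ring. Qed.

(* The two arguments are [- PI] and [PI], where the exponential agrees. *)
Lemma cpower_conj_angle r t : 0 < r -> 0 < t < PI ->
  cpower (RtoC r * (cos t, (- sin t)%R))%C (- (PI / t)) =
  cpower (RtoC r * (cos t, sin t))%C (- (PI / t)).
Proof.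
intros hr ht; unfold cpower.
rewrite Carg_polar_up, Carg_polar_down, Cmod_polar_conj by trivial.
replace (- (PI / t) * - t) with PI by (field; lra).
replace (- (PI / t) * t) with (- PI) by (field; lra).
rewrite cos_neg, sin_neg, sin_PI, Ropp_0; reflexivity.
Qed.

(** sin(theta) equals sqrt(sigma11 sigma22 - sigma12^2) / sqrt(sigma11 sigma22), and [qfun p 1] is
    minus that determinant; the slope is therefore c_-, the conjugate of [c_plus p]. *)
Lemma Xp_slope_1 p : is_model p -> zero_drift p -> non_degenerate p ->
  Xp_slope p 1 =
  (RtoC (sqrt (sigma22 p / sigma11 p)) * (cos (theta p), (- sin (theta p))%R))%C.
Proof.
intros Hp Hzd Hnd; pose proof (sigma_det_pos p Hp Hnd) as hd.
destruct (sigma_pos p Hp Hnd) as [h1 h2].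
pose proof (theta_cos_bounds p Hp Hnd) as hc.
unfold Xp_slope, theta; rewrite cos_acos, sin_acos by lra.
rewrite ta_1, qfun_1 by trivial.
replace (wfun p 1) with (sigma12 p) by (unfold wfun; ring).
rewrite sqrt_div, sqrt_mult by lra.
assert (e1 := sqrt_sqrt (sigma11 p) ltac:(lra)); assert (e2 := sqrt_sqrt (sigma22 p) ltac:(lra)).
assert (p1 := sqrt_lt_R0 _ h1); assert (p2 := sqrt_lt_R0 _ h2).
set (s := sqrt (sigma11 p)) in *; set (t := sqrt (sigma22 p)) in *.
replace (1 - (- sigma12 p / (s * t))²) with
  ((- (sigma12 p ^ 2 - sigma11 p * sigma22 p)) / ((s * t) ^ 2)).
2: { rewrite <- e1, <- e2; unfold Rsqr; field; lra. }
assert (0 < s * t) by (apply Rmult_lt_0_compat; trivial).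
rewrite sqrt_div, (sqrt_pow2 (s * t)) by (try apply pow_lt; lra).
rewrite <- e1 at 1 3.
apply injective_projections; simpl; field; lra.
Qed.

Lemma gamma_pos p x y : is_model p -> non_degenerate p -> 0 < x -> 0 < y ->
  0 < gamma p x y.
Proof.
intros Hp Hnd hx hy; pose proof (sigma_det_pos p Hp Hnd) as hd.
destruct (sigma_pos p Hp Hnd) as [h1 h2]; unfold gamma.
(* Completing the square in x after multiplication by 2 sigma11 leaves the determinant times y^2. *)
apply Rmult_lt_reg_l with (2 * sigma11 p); [lra|].
match goal with |- _ < ?u => replace u with
  ((sigma11 p * x + sigma12 p * y) ^ 2 + (sigma11 p * sigma22 p - sigma12 p ^ 2) * (y * y))
  by field end.
pose proof (pow2_ge_0 (sigma11 p * x + sigma12 p * y)).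
assert (0 < (sigma11 p * sigma22 p - sigma12 p ^ 2) * (y * y)) by (apply Rmult_lt_0_compat; nra).
lra.
Qed.

(** * Scaled limits of omega, of P_k and of the kernel *)

(** With 1 - z = mu D, the positive factor mu leaves the principal power and cancels mu^{PI/theta}.
    The limit of the power of D is a separate hypothesis because it is obtained differently on the
    positive axis and in the lower half-plane. *)
Lemma scaled_omega p y1 omega beta (z D : R -> C) (D0 L : C) :
  filterlim (fun z => omega z / cpower (1 - z) (- (PI / theta p)))%C
    (within (domG_bar p y1) (locally (RtoC 1))) (locally beta) ->
  at_right 0 (fun mu => domG_bar p y1 (z mu)) ->
  at_right 0 (fun mu => (1 - z mu)%C = (RtoC mu * D mu)%C) ->
  filterlim D (at_right 0) (locally D0) ->
  filterlim (fun mu => cpower (D mu) (- (PI / theta p))) (at_right 0) (locally L) ->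
  filterlim (fun mu => RtoC (Rpower mu (PI / theta p)) * omega (z mu))%C
    (at_right 0) (locally (beta * L)%C).
Proof.
intros hb hz hD hD0 hL; set (E := PI / theta p) in *.
assert (hz1 : filterlim z (at_right 0) (locally (RtoC 1))).
{ apply filterlim_ext_loc with (fun mu => (1 - RtoC mu * D mu)%C).
  - revert hD; apply filter_imp; intros mu h; rewrite <- h; ring.
  - replace (locally (RtoC 1)) with (locally (1 - RtoC 0 * D0)%C)
      by (f_equal; ring).
    apply (filterlim_Cminus (at_right 0)); [apply filterlim_const|].
    apply (filterlim_Cmult (at_right 0)); [|exact hD0].
    apply (filterlim_RtoC (at_right 0)), filterlim_at_right_id. }
assert (hw : filterlim z (at_right 0) (within (domG_bar p y1) (locally (RtoC 1)))).
{ intros P hP; specialize (hz1 _ hP); unfold filtermap in *.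
  generalize (filter_and _ _ hz hz1); apply filter_imp; intros mu [h1 h2]; auto. }
pose proof (filterlim_comp _ _ _ _ _ _ _ _ hw hb) as hq; simpl in hq.
refine (filterlim_ext_loc _ _ _ (filterlim_Cmult (at_right 0) _ _ _ _ hq hL)).
generalize (filter_and _ _ hz (filter_and _ _ hD (at_right_pos (fun mu => 0 < mu) (fun mu h => h)))).
apply filter_imp; intros mu [hd [h hmu]].
(* D = 0 would give z = 1, a point removed from [domG_bar]. *)
assert (hDn : D mu <> RtoC 0).
{ intros E0; rewrite E0 in h; apply (proj2 hd).
  replace (z mu) with (1 - (1 - z mu))%C by ring; rewrite h; ring. }
pose proof (cpower_neq0 (D mu) (- E)) as hn.
rewrite h, cpower_scale, Rpower_Ropp by trivial.
assert (hr : RtoC (Rpower mu E) <> RtoC 0).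
{ intros e; injection e; apply Rgt_not_eq, exp_pos. }
rewrite RtoC_inv; [|intros e; apply hr; rewrite e; reflexivity].
field; auto.
Qed.

Lemma Rpower_INR_mult mu E k : Rpower mu (INR k * E) = Rpower mu E ^ k.
Proof.
rewrite Rmult_comm, <- Rpower_mult; apply Rpower_pow, exp_pos.
Qed.

(* [Ppoly] is monic of degree k, so only its leading term survives where f blows up. *)
Lemma scaled_Ppoly p d0 k E (f : R -> C) (L : C) : 0 < E ->
  filterlim (fun mu => RtoC (Rpower mu E) * f mu)%C (at_right 0) (locally L) ->
  filterlim (fun mu => RtoC (Rpower mu (INR k * E)) * Ppoly p d0 k (f mu))%C
    (at_right 0) (locally (L ^ k)%C).
Proof.
intros hE hf.
(* Since mu^E tends to 0, the shift by [d0] disappears: both kinds of factors of P_k have the same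
   scaled limit. *)
assert (h0 : filterlim (fun mu => (RtoC (Rpower mu E) * f mu - RtoC (Rpower mu E) * d0)%C)
   (at_right 0) (locally L)).
{ replace (locally L) with (locally (L - RtoC 0 * d0)%C) by (f_equal; ring).
  apply (filterlim_Cminus (at_right 0)); trivial.
  apply (filterlim_Cmult (at_right 0)); [|apply filterlim_const].
  apply (filterlim_RtoC (at_right 0)), filterlim_Rpower_0, hE. }
unfold Ppoly; destruct (Ceq_dec (kernel p 0 0) 0) as [_|_].
- eapply filterlim_ext; [|exact (filterlim_Cpow (at_right 0) _ _ k hf)].
  intros mu; cbv beta; rewrite Rpower_INR_mult, RtoC_pow, Cpow_mult_l; reflexivity.
- set (m := Nat.div2 k); pose proof (Nat.div2_odd k) as ek; fold m in ek.
  rewrite <- Nat.negb_even in ek; destruct (Nat.even k); simpl in ek.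
  + replace (L ^ k)%C with (L ^ m * L ^ m)%C by (rewrite <- Cpow_add_r; f_equal; lia).
    eapply filterlim_ext; [|exact (filterlim_Cmult (at_right 0) _ _ _ _
      (filterlim_Cpow (at_right 0) _ _ m hf) (filterlim_Cpow (at_right 0) _ _ m h0))].
    intros mu; cbv beta; rewrite Rpower_INR_mult, RtoC_pow.
    replace (RtoC (Rpower mu E) ^ k)%C with (RtoC (Rpower mu E) ^ m * RtoC (Rpower mu E) ^ m)%C
      by (rewrite <- Cpow_add_r; f_equal; lia).
    replace (RtoC (Rpower mu E) * f mu - RtoC (Rpower mu E) * d0)%C
      with (RtoC (Rpower mu E) * (f mu - d0))%C by ring.
    rewrite !Cpow_mult_l; ring.
  + replace (L ^ k)%C with (L ^ (m + 1) * L ^ m)%C by (rewrite <- Cpow_add_r; f_equal; lia).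
    eapply filterlim_ext; [|exact (filterlim_Cmult (at_right 0) _ _ _ _
      (filterlim_Cpow (at_right 0) _ _ (m + 1) hf) (filterlim_Cpow (at_right 0) _ _ m h0))].
    intros mu; cbv beta; rewrite Rpower_INR_mult, RtoC_pow.
    replace (RtoC (Rpower mu E) ^ k)%C
      with (RtoC (Rpower mu E) ^ (m + 1) * RtoC (Rpower mu E) ^ m)%C
      by (rewrite <- Cpow_add_r; f_equal; lia).
    replace (RtoC (Rpower mu E) * f mu - RtoC (Rpower mu E) * d0)%C
      with (RtoC (Rpower mu E) * (f mu - d0))%C by ring.
    rewrite !Cpow_mult_l; ring.
Qed.

Lemma filterlim_exp_scaled y :
  filterlim (fun mu => exp (- (mu * y))) (at_right 0) (locally 1).
Proof.
replace (locally 1) with (locally (exp (- (0 * y))))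
  by (f_equal; rewrite Rmult_0_l, Ropp_0, exp_0; reflexivity).
apply (filterlim_continuous_comp (at_right 0) _ exp); [apply continuous_exp|].
apply (filterlim_Ropp (at_right 0)), (filterlim_Rmult (at_right 0));
  [apply filterlim_at_right_id|apply filterlim_const].
Qed.

(** Divided by mu^2, [kernel_at_one] is exactly a quadratic form in the slopes [u] and [v], which
    tend to x and y; its coefficients tend to sigma11/2, sigma12 and sigma22/2. *)
Lemma scaled_kernel p x y : is_model p -> zero_drift p -> 0 < x -> 0 < y ->
  filterlim (fun mu => kernel p (RtoC (exp (- (mu * x)))) (RtoC (exp (- (mu * y))))
                        / RtoC (mu ^ 2))%C
    (at_right 0) (locally (RtoC (gamma p x y))).
Proof.
intros Hp Hzd hx hy.
set (u := fun mu => (1 - exp (- (mu * x))) / mu).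
set (v := fun mu => (1 - exp (- (mu * y))) / mu).
assert (hu : filterlim u (at_right 0) (locally x)) by (apply filterlim_exp_slope; lra).
assert (hv : filterlim v (at_right 0) (locally y)) by (apply filterlim_exp_slope; lra).
pose proof (filterlim_exp_scaled y) as hY.
pose proof (filterlim_continuous_comp (at_right 0) _ (ta p) 1 (continuous_ta p 1) hY) as h1.
pose proof (filterlim_continuous_comp (at_right 0) _ (wfun p) 1 (continuous_wfun p 1) hY) as h2.
apply filterlim_ext_loc with (fun mu =>
  RtoC (ta p (exp (- (mu * y))) * (u mu * u mu) + wfun p (exp (- (mu * y))) * (u mu * v mu)
   + sigma22 p / 2 * (v mu * v mu))).
{ apply at_right_pos; intros mu hmu; rewrite kernel_at_one by trivial; unfold u, v.
  rewrite <- RtoC_div by (apply pow_nonzero; lra); f_equal; field; lra. }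
apply (filterlim_RtoC (at_right 0)).
replace (gamma p x y) with (ta p 1 * (x * x) + wfun p 1 * (x * y) + sigma22 p / 2 * (y * y))
  by (rewrite ta_1 by trivial; unfold gamma, wfun; field).
repeat apply (filterlim_Rplus (at_right 0)); apply (filterlim_Rmult (at_right 0));
  trivial; try apply (filterlim_Rmult (at_right 0)); trivial; apply filterlim_const.
Qed.

Lemma exp_in_01 t : 0 < t -> 0 < exp (- t) < 1.
Proof.
intros ht; split; [apply exp_pos|]; rewrite <- exp_0; apply exp_increasing; lra.
Qed.

(** * Both arguments of omega eventually lie in the closure of G, away from 1 *)

Section Boundary.
Context (p : Z -> Z -> R) (y1 : R) (Hp : is_model p) (Hzd : zero_drift p)
  (Hnd : non_degenerate p) (Hy1 : -1 <= y1 < 1) (Hdisc : discr p y1 = 0).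

Lemma exp_in_domG_bar x : (p 1%Z 1%Z = 0 -> p 0%Z 1%Z <> 0) -> 0 < x ->
  at_right 0 (fun mu => domG_bar p y1 (RtoC (exp (- (mu * x))))).
Proof.
intros HK hx; apply at_right_pos; intros mu hmu.
pose proof (exp_in_01 (mu * x) ltac:(nra)) as h; split.
- left; apply segment_in_domG; trivial; lra.
- intros E; injection E; lra.
Qed.

(** For small mu, e^{-mu y} exceeds y1 and [qfun] is negative there by continuity from 1. So X_+ is
    a point of the curve, and its nonzero imaginary part separates it from 1. *)
Lemma Xp_exp_eventually y : 0 < y ->
  at_right 0 (fun mu => domG_bar p y1 (Xp p (exp (- (mu * y)))) /\
    (1 - Xp p (exp (- (mu * y))) =
      RtoC mu * (RtoC ((1 - exp (- (mu * y))) / mu) * Xp_slope p (exp (- (mu * y)))))%C).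
Proof.
intros hy; pose proof (filterlim_exp_scaled y) as hY.
pose proof (filterlim_continuous_comp (at_right 0) _ (qfun p) 1 (continuous_qfun p 1) hY) as hq.
pose proof (hq _ (open_lt 0 _ (qfun_1_neg p Hp Hzd Hnd))) as h1.
pose proof (hY _ (open_gt y1 1 (proj2 Hy1))) as h2; unfold filtermap in h1, h2.
generalize (filter_and _ _ h1 (filter_and _ _ h2
  (at_right_pos (fun mu => 0 < mu) (fun mu h => h)))); apply filter_imp.
intros mu (hqn & hgt & hmu); set (Y := exp (- (mu * y))) in *.
assert (hY01 : 0 < Y < 1) by (apply exp_in_01; nra).
pose proof (ta_pos p Y Hp Hzd Hnd ltac:(lra)) as ha.
assert (hX : (1 - Xp p Y = RtoC (1 - Y) * Xp_slope p Y)%C) by (apply Xp_near_1; trivial).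
split.
- split.
  + right; exists Y; repeat split; try lra; auto.
  + intros E; rewrite E in hX.
    apply (f_equal snd) in hX; simpl in hX.
    assert (0 < sqrt (- qfun p Y)) by (apply sqrt_lt_R0; lra).
    assert (0 < sqrt (- qfun p Y) / (2 * ta p Y)) by (apply Rdiv_lt_0_compat; lra).
    assert (- sqrt (- qfun p Y) / (2 * ta p Y) = - (sqrt (- qfun p Y) / (2 * ta p Y)))
      by (field; lra).
    nra.
- rewrite hX, Cmult_assoc, <- RtoC_mult; do 2 f_equal; field; lra.
Qed.
End Boundary.

(** * Assembly of the limit of the scaled [H1] *)

Theorem theorem4 (p : Z -> Z -> R) (y1 : R) (omega : C -> C) (d0 : C)
  (Hp : is_model p)
  (Hnd : non_degenerate p)
  (Hzd : zero_drift p)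
  (HK0 : kernel p 0 0 = RtoC 0 -> C_derive (fun x => kernel p x 0) 0 <> RtoC 0)
  (Hy1 : -1 <= y1 < 1)
  (Hdisc : discr p y1 = 0)
  (Homega : conformal_gluing p y1 omega)
  (Hd0 : kernel p 0 0 <> RtoC 0 -> is_d0 p omega d0) :
  forall k : nat, (1 <= k)%nat ->
  exists alpha : C, alpha <> RtoC 0 /\
    forall x y : R, 0 < x -> 0 < y ->
      filterlim
        (fun mu : R =>
           (RtoC (Rpower mu (INR k * PI / theta p + 2)) *
            H1 p omega d0 k (RtoC (exp (- (mu * x)))) (exp (- (mu * y))))%C)
        (at_right 0)
        (locally (alpha * Lh1 p k x y)%C).
Proof.
intros k _.
destruct (gluing_1 _ _ _ Homega) as (beta & hb & hbeta).
exists (beta ^ k)%C; split; [apply Cpow_nz, hb|]; intros x y hx hy.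
pose proof (kernel_simple_root p HK0) as HK.
pose proof (theta_bounds p Hp Hnd) as ht.
set (E := PI / theta p); assert (hE : 0 < E) by (apply Rdiv_lt_0_compat; lra).
set (c := sqrt (sigma22 p / sigma11 p)).
assert (hc : 0 < c).
{ destruct (sigma_pos p Hp Hnd); apply sqrt_lt_R0, Rdiv_lt_0_compat; trivial. }
assert (hx' : filterlim (fun mu => RtoC (Rpower mu E) * omega (RtoC (exp (- (mu * x)))))%C
  (at_right 0) (locally (beta * omega_hat p (RtoC x))%C)).
{ pose proof (filterlim_exp_slope x ltac:(lra)) as hs.
  apply scaled_omega with (y1 := y1) (D := fun mu => RtoC ((1 - exp (- (mu * x))) / mu))
    (D0 := RtoC x); trivial.
  - apply exp_in_domG_bar; trivial.
  - apply at_right_pos; intros mu hmu.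
    rewrite <- RtoC_mult, <- RtoC_minus; f_equal; field; lra.
  - apply (filterlim_RtoC (at_right 0)), hs.
  - unfold omega_hat; rewrite cpower_pos by trivial.
    apply filterlim_ext_loc with (fun mu => RtoC (Rpower ((1 - exp (- (mu * x))) / mu) (- E))).
    + apply at_right_pos; intros mu hmu; rewrite cpower_pos; trivial.
      pose proof (exp_in_01 (mu * x) ltac:(nra)); apply Rdiv_lt_0_compat; lra.
    + apply (filterlim_RtoC (at_right 0)).
      apply (filterlim_continuous_comp (at_right 0) _ (fun u => Rpower u (- E))); trivial.
      apply continuous_Rpower, hx. }
assert (hy' : filterlim (fun mu => RtoC (Rpower mu E) * omega (Xp p (exp (- (mu * y)))))%C
  (at_right 0) (locally (beta * omega_hat p (c_plus p * RtoC y))%C)).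
{ pose proof (Xp_exp_eventually p y1 Hp Hzd Hnd Hy1 y hy) as he.
  assert (hD : filterlim (fun mu => RtoC ((1 - exp (- (mu * y))) / mu)
      * Xp_slope p (exp (- (mu * y))))%C (at_right 0) (locally (RtoC y * Xp_slope p 1)%C)).
  { apply (filterlim_Cmult (at_right 0)).
    - apply (filterlim_RtoC (at_right 0)), filterlim_exp_slope; lra.
    - apply Xp_slope_continuous; trivial; [typeclasses eauto|apply filterlim_exp_scaled]. }
  assert (eS : (RtoC y * Xp_slope p 1 = RtoC (y * c) * (cos (theta p), (- sin (theta p))%R))%C).
  { rewrite Xp_slope_1 by trivial; fold c; rewrite RtoC_mult; ring. }
  apply scaled_omega with (4 := hD) (y1 := y1); trivial.
  - revert he; apply filter_imp; intros mu [h _]; exact h.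
  - revert he; apply filter_imp; intros mu [_ h]; exact h.
  - unfold omega_hat, c_plus; fold c.
    replace (RtoC c * (cos (theta p), sin (theta p)) * RtoC y)%C
      with (RtoC (y * c) * (cos (theta p), sin (theta p)))%C by (rewrite RtoC_mult; ring).
    (* The target at c_+ y is replaced by the equal power at c_- y, the actual limit of the slopes,
       which lies in the lower half-plane as [filterlim_cpower] requires. *)
    rewrite <- cpower_conj_angle, <- eS by (trivial; nra).
    apply (filterlim_cpower (at_right 0)); trivial.
    rewrite eS; simpl; pose proof (sin_gt_0 (theta p) ltac:(lra) ltac:(lra)).
    assert (0 < y * c * sin (theta p)) by (apply Rmult_lt_0_compat; nra); lra. }
pose proof (scaled_kernel p x y Hp Hzd hx hy) as hK.
pose proof (gamma_pos p x y Hp Hnd hx hy) as hg.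
(* K/mu^2 tends to gamma > 0, so K is eventually nonzero and the division in [H1] is genuine. *)
assert (hKp : at_right 0 (fun mu =>
  0 < fst (kernel p (RtoC (exp (- (mu * x)))) (RtoC (exp (- (mu * y)))) / RtoC (mu ^ 2))%C)).
{ exact (proj1 (proj1 (filterlim_C (at_right 0) _ _) hK) _ (open_gt 0 _ hg)). }
pose proof (scaled_Ppoly p d0 k E _ _ hE hx') as hP1.
pose proof (scaled_Ppoly p d0 k E _ _ hE hy') as hP2.
assert (hg0 : RtoC (gamma p x y) <> RtoC 0) by (intros e; injection e; lra).
pose proof (filterlim_Cmult (at_right 0) _ _ _ _
  (filterlim_Cminus (at_right 0) _ _ _ _ hP1 hP2)
  (filterlim_Cinv (at_right 0) _ _ hg0 hK)) as hlim.
replace (beta ^ k * Lh1 p k x y)%C with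
  (((beta * omega_hat p x) ^ k - (beta * omega_hat p (c_plus p * y)) ^ k)
     * / gamma p x y)%C
  by (unfold Lh1; rewrite !Cpow_mult_l; field; trivial).
refine (filterlim_ext_loc _ _ _ hlim).
generalize (filter_and _ _ hKp (at_right_pos (fun mu => 0 < mu) (fun mu h => h))).
apply filter_imp; intros mu [hn hmu]; unfold H1.
set (K := kernel p (RtoC (exp (- (mu * x)))) (RtoC (exp (- (mu * y))))) in hn |- *.
assert (hm : RtoC (mu ^ 2) <> RtoC 0) by (intros e; injection e; nra).
assert (hK0 : K <> RtoC 0).
{ intros e; rewrite e in hn; unfold Cdiv in hn; rewrite Cmult_0_l in hn; simpl in hn; lra. }
replace (INR k * PI / theta p) with (INR k * E) by (unfold E; field; lra).
(* The real exponent 2 is read as a natural number, so that this power of mu becomes [mu ^ 2] and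
   matches the scaling of the kernel. *)
change 2 with (INR 2) at 1; rewrite Rpower_plus, Rpower_pow, RtoC_mult by trivial.
field; auto.
Qed.
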